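(* Let $d\ge1$ and let $k\in[1,d]$ be a real number. Then the ($d$-dimensional) volume of $\rho_{d,k}^\star$ is $$2^d\sum_{i=0}^{\lfloor k\rfloor}\frac{(-1)^i(k-i)^d}{i!\,(d-i)!}.$$
   Context: $\gamma_d=[-1,1]^d\subset\mathbb{R}^d$ is the hypercube, and $\beta_d=\mathrm{conv}\{\pm e_1,\dots,\pm e_d\}$ is the cross-polytope (the unit ball of the $1$-norm). For $k\in[1,d]$, $\rho_{d,k}=\mathrm{conv}\left(\beta_d\cup\frac1k\gamma_d\right)$ and $\rho_{d,k}^\star$ is its polar, that is, $\rho_{d,k}^\star=(k\beta_d)\cap\gamma_d$. *)

(* Defs.v *)
From HB Require Import structures.
From mathcomp Require Import all_boot all_order all_algebra.
From mathcomp Require Import all_classical all_reals all_analysis.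

Set Implicit Arguments.
Unset Strict Implicit.
Unset Printing Implicit Defensive.

Import Order.TTheory GRing.Theory Num.Theory.
Import numFieldNormedType.Exports.

Local Open Scope classical_set_scope.
Local Open Scope ring_scope.

(* The library has no Lebesgue measure on R^n. It is built here on n-tuples,
   by induction on n, as the product of the Lebesgue measure on R with the one
   on R^(n-1), pushed forward along (x, t) |-> x :: t. *)

Section lebesgue_cons.
Variables (R : realType) (n : nat).
Local Notation T := (measurableTypeR R).
Variable mu : {sigma_finite_measure set (n.-tuple T) -> \bar R}.

Definition cons_pair (p : T * n.-tuple T) : n.+1.-tuple T :=
  [tuple of p.1 :: p.2].

Definition uncons (t : n.+1.-tuple T) : T * n.-tuple T :=
  (thead t, [tuple of behead t]).

Lemma cons_pairK : cancel cons_pair uncons.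
Proof. by case=> x t; congr pair; apply: val_inj. Qed.

Lemma unconsK : cancel uncons cons_pair.
Proof. by move=> t; rewrite [RHS]tuple_eta; exact: val_inj. Qed.

Lemma measurable_cons_pair : measurable_fun [set: T * n.-tuple T] cons_pair.
Proof. exact: measurable_cons measurable_fst measurable_snd. Qed.

Lemma measurable_uncons : measurable_fun [set: n.+1.-tuple T] uncons.
Proof.
apply: measurable_fun_pair; first exact: measurable_tnth.
exact: measurable_behead.
Qed.

Definition lebesgue_cons : set (n.+1.-tuple T) -> \bar R :=
  pushforward (@lebesgue_measure R \x mu)%E cons_pair.

Let m := measure_function_pushforward__canonical__measure_function_Measure
  (@lebesgue_measure R \x mu)%E measurable_cons_pair.

Let lebesgue_cons0 : lebesgue_cons set0 = 0%E.
Proof. exact: (measure0 m). Qed.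

Let lebesgue_cons_ge0 A : (0 <= lebesgue_cons A)%E.
Proof. exact: (measure_ge0 m). Qed.

Let lebesgue_cons_sigma_additive : semi_sigma_additive lebesgue_cons.
Proof. exact: (@measure_semi_sigma_additive _ _ _ m). Qed.

HB.instance Definition _ := isMeasure.Build _ _ _ lebesgue_cons
  lebesgue_cons0 lebesgue_cons_ge0 lebesgue_cons_sigma_additive.

Let lebesgue_cons_sigma_finite : sigma_finite setT lebesgue_cons.
Proof.
pose leb : {sigma_finite_measure set T -> \bar R} := @lebesgue_measure R.
have [F FT Foo] : sigma_finite setT (leb \x mu)%E.
  (* [sigma_finiteT] only infers the instance of [\x] for probabilities. *)
  by case: (lebesgue_integral_fubini.measure_function_Measure_isSigmaFinite__to__measure_function_isSigmaFinite
              leb mu).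
exists (fun i => uncons @^-1` F i) => [|i].
  by rewrite -preimage_bigcup -FT preimage_setT.
have [mF Fi] := Foo i; split.
  by rewrite -[X in measurable X]setTI; exact: measurable_uncons.
rewrite /lebesgue_cons /pushforward -comp_preimage.
by rewrite (_ : uncons \o cons_pair = id)//; apply/funext/cons_pairK.
Qed.

HB.instance Definition _ := @Measure_isSigmaFinite.Build _ _ _ lebesgue_cons
  lebesgue_cons_sigma_finite.

End lebesgue_cons.

Fixpoint lebesgue_tuple (R : realType) (n : nat) :
    {sigma_finite_measure set (n.-tuple (measurableTypeR R)) -> \bar R} :=
  if n is m.+1 then lebesgue_cons (lebesgue_tuple R m)
  else \d_([tuple] : 0.-tuple (measurableTypeR R)).

Lemma lebesgue_tuple_box (R : realType) (n : nat)
    (A : 'I_n -> set (measurableTypeR R)) :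
  (forall i, measurable (A i)) ->
  lebesgue_tuple R n [set t | forall i, A i (tnth t i)] =
  (\prod_(i < n) lebesgue_measure (A i))%E.
Proof.
elim: n A => [|n IHn] A mA.
  by rewrite big_ord0 /= diracE mem_set// => -[].
rewrite big_ord_recl -IHn// /= /lebesgue_cons /pushforward.
rewrite -product_measure1E//; last first.
  have -> : [set t : n.-tuple (measurableTypeR R) |
      forall i, A (lift ord0 i) (tnth t i)] =
      \bigcap_(i in [set: 'I_n]) ((@tnth _ _)^~ i @^-1` A (lift ord0 i)).
    by apply/seteqP; split => [t At i _|t At i]; [exact: At|exact: (At i I)].
  apply: fin_bigcap_measurable => // i _.
  by rewrite -[X in measurable X]setTI; exact: measurable_tnth.
congr (product_measure1 _ _ _); apply/seteqP; split => -[x t] /=.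
  move=> At; split; first exact: (At ord0).
  by move=> i; move: (At (lift ord0 i)); rewrite /cons_pair tnthS.
case=> Ax At i; have [->//|] := eqVneq i ord0.
by rewrite eq_sym => /unlift_some[j -> _]; rewrite /cons_pair tnthS; exact: At.
Qed.

(* Lebesgue measure transported to row vectors, which carry the linear
   structure that convexity needs. The value is meaningful on Borel sets. *)
Definition volume (R : realType) (d : nat) (A : set 'rV[R]_d) : \bar R :=
  lebesgue_tuple R d [set t | A (\row_i tnth t i)].

Section polytopes.
Variables (R : realType) (d : nat).
Implicit Types (A : set 'rV[R]_d) (k : R).

Definition conv_hull A : set 'rV[R]_d :=
  smallest (@convex_set R 'rV[R]_d) A.

Definition polar A : set 'rV[R]_d :=
  [set y | forall x, A x -> \sum_i x 0 i * y 0 i <= 1].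

Definition hypercube : set 'rV[R]_d := [set x | forall i, -1 <= x 0 i <= 1].

Definition cross_polytope : set 'rV[R]_d :=
  conv_hull [set x | exists i, x = delta_mx 0 i \/ x = - delta_mx 0 i].

Definition rho k : set 'rV[R]_d :=
  conv_hull (cross_polytope `|` [set k^-1 *: x | x in hypercube]).

Definition rho_star k : set 'rV[R]_d := polar (rho k).

End polytopes.

Arguments hypercube {R} d.
Arguments cross_polytope {R} d.
Arguments rho {R} d k.
Arguments rho_star {R} d k.

(* Main.v *)
(* Pairing with the points +-e_i and the sign vectors scaled by 1/k shows that
   rho_star is the set of y with |y_i| <= 1 and sum_i |y_i| <= k. Slicing along
   the first coordinate, the volume V_n(k) of this set, for an arbitrary real
   k, satisfies
     V_(n+1)(k) = int_(-1)^1 V_n(k - |x|) dx = 2 int_(k-1)^k V_n.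
   Writing D f (y) = f y - f (y - 1), and since max(0, y)^(n+1) / (n+1) is an
   antiderivative of max(0, y)^n, induction gives
     V_n = 2^n / n! * D^n (y |-> max(0, y)^n),
   and expanding D^n with binomial coefficients yields the formula. *)

Require Import Defs.
From mathcomp Require Import all_boot all_order all_algebra.
From mathcomp Require Import all_classical all_reals all_analysis.
From mathcomp Require Import measurable_realfun ring lra.

Import Order.TTheory GRing.Theory Num.Theory.
Import numFieldNormedType.Exports.

Local Open Scope ring_scope.

(** * The polar as a system of inequalities *)

Section rho_star.
Variables (R : realType) (d : nat).
Implicit Types (A : set 'rV[R]_d) (k : R) (y : 'rV[R]_d).
Local Open Scope classical_set_scope.

Lemma sub_conv_hull A : A `<=` conv_hull A.
Proof. exact: sub_smallest. Qed.

(** Since [conv_hull] is the smallest convex superset, convexity of this half-space reduces the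
    polar inequality on a hull to its generators. *)
Lemma convex_halfspace y :
  @convex_set R 'rV[R]_d [set x | \sum_i x 0 i * y 0 i <= 1].
Proof.
move=> u v l; rewrite !inE /= => u1 v1.
have -> : \sum_i conv l u v 0 i * y 0 i =
    l%:num * (\sum_i u 0 i * y 0 i) + (1 - l%:num) * (\sum_i v 0 i * y 0 i).
  rewrite !mulr_sumr -big_split /=; apply: eq_bigr => i _.
  by rewrite !mxE mulrDl -!mulrA.
have l0 : 0 <= l%:num by [].
have l1 : 0 <= 1 - l%:num by rewrite subr_ge0.
nra.
Qed.

Lemma rho_starE k : 0 < k ->
  rho_star d k = [set y | (forall i, `|y 0 i| <= 1) /\ \sum_i `|y 0 i| <= k].
Proof.
move=> k0; apply/seteqP; split => y /=.
  move=> yrho; split => [i|].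
    rewrite ler_norml lerNl; apply/andP; split.
      have /yrho : rho d k (- delta_mx 0 i).
        apply: sub_conv_hull; left; apply: sub_conv_hull.
        by exists i; right.
      rewrite (bigD1 i)//= big1 => [|j ji].
        by rewrite !mxE !eqxx addr0 mulN1r.
      by rewrite !mxE eqxx (negPf ji) oppr0 mul0r.
    have /yrho : rho d k (delta_mx 0 i).
      apply: sub_conv_hull; left; apply: sub_conv_hull.
      by exists i; left.
    rewrite (bigD1 i)//= big1 => [|j ji].
      by rewrite !mxE !eqxx addr0 mul1r.
    by rewrite !mxE eqxx (negPf ji) mul0r.
  (* The signs of [y] turn the pairing into the sum of the |y_i|; a zero coordinate gets sign 0,
     which still lies in the cube. *)
  have /yrho : rho d k (k^-1 *: \row_i Num.sg (y 0 i)).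
    apply: sub_conv_hull; right; exists (\row_i Num.sg (y 0 i)) => // i.
    by rewrite mxE -ler_norml normr_sg lern1 leq_b1.
  rewrite -[k in _ -> _ <= k]mulr1 -ler_pdivrMl// mulr_sumr.
  by under eq_bigr do rewrite !mxE -mulrA -normrEsg.
(* Conversely, the outer hull and then the cross-polytope are tested on generators only: ±e_i uses
   the coordinate bounds, the scaled cube uses the bound on the sum. *)
case=> y1 yk; apply: smallest_sub; first exact: convex_halfspace.
move=> x [|[z zc <-]] /=.
  apply: (smallest_sub (convex_halfspace y)) => // {}x [i [->|->]] /=;
    rewrite (bigD1 i)//= big1 => [|j ji].
  - by rewrite !mxE !eqxx addr0 mul1r (le_trans (ler_norm _)).
  - by rewrite !mxE eqxx (negPf ji) mul0r.
  - by rewrite !mxE !eqxx addr0 mulN1r (le_trans (ler_norm _))// normrN.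
  - by rewrite !mxE eqxx (negPf ji) oppr0 mul0r.
under eq_bigr do rewrite mxE -mulrA.
rewrite -mulr_sumr ler_pdivrMl// mulr1 (le_trans _ yk)//.
apply: ler_sum => i _; rewrite (le_trans (ler_norm _))// normrM.
by rewrite ler_piMl// ler_norml; exact: zc.
Qed.

End rho_star.

(** * Truncated powers and their iterated backward differences *)

Section truncated_cube.
Variable R : realType.
Implicit Types (f : R -> R) (m n : nat) (x y : R).

(* For m = 0 this is constantly 1, not the Heaviside step function: the volume
   recursion therefore starts in dimension 1. *)
Definition pospow m y : R := Num.max 0 y ^+ m.

Definition backward_diff f y : R := f y - f (y - 1).

Local Notation bdiff n f := (iter n backward_diff f).

(** Induction by Pascal's rule: C(n, i+1) comes from the value at [y], C(n, i) from the value at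
    [y - 1], whose minus sign goes into (-1)^(i+1). *)
Lemma iter_backward_diff n f y :
  bdiff n f y = \sum_(i < n.+1) (-1) ^+ i * 'C(n, i)%:R * f (y - i%:R).
Proof.
elim: n y => [|n IHn] y; first by rewrite big_ord1 /= bin0 subr0 !mul1r.
rewrite iterS /backward_diff !IHn big_ord_recl bin0 subr0.
rewrite [RHS]big_ord_recl bin0 subr0 -addrA; congr +%R.
under [RHS]eq_bigr => i _ do
  rewrite lift0 binS natrD mulrDr mulrDl.
rewrite big_split /= [in RHS]big_ord_recr /= [in RHS]bin_small//.
rewrite mulr0 mul0r addr0.
congr +%R; rewrite -sumrN; apply: eq_bigr => i _.
rewrite exprS !mulNr mul1r; congr (- (_ * f _)).
by rewrite -natr1; ring.
Qed.

Lemma pospow_out m y : y <= 0 -> pospow m.+1 y = 0.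
Proof. by move=> y0; rewrite /pospow (max_idPl y0) expr0n. Qed.

Lemma pospow_in m y : 0 <= y -> pospow m y = y ^+ m.
Proof. by move=> y0; rewrite /pospow (max_idPr y0). Qed.

Lemma continuous_pospow m : continuous (pospow m : R -> R).
Proof.
move=> x; apply: (continuous_comp _ (@exprn_continuous _ m _)).
by apply: continuous_max => //; exact: cst_continuous.
Qed.

(** The exponent starts at 2 because max(0, y) has a corner at 0. Away from 0 the function is
    locally zero or a monomial. *)
Lemma is_derive_pospow m x :
  is_derive x 1 (pospow m.+2 : R -> R) (m.+2%:R * pospow m.+1 x).
Proof.
have [x0|x0|->] := ltgtP x 0.
- rewrite pospow_out ?ltW// mulr0.
  apply: (@near_eq_is_derive _ _ _ (cst 0)).
  near=> y; rewrite pospow_out//= ltW//; near: y.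
  exact: lt_nbhsl.
- rewrite pospow_in ?ltW//.
  apply: (@near_eq_is_derive _ _ _ (fun y : R => y ^+ m.+2)).
    near=> y; rewrite pospow_in// ltW//; near: y.
    exact: lt_nbhsr.
  have := is_deriveX m.+2 (is_derive_id x 1).
  rewrite exprfctE => /is_derive_eq; apply.
  by rewrite /GRing.scale/= mulr1.
- rewrite pospow_out// mulr0.
  (* For nonzero increments the difference quotient at 0 is exactly [pospow m.+1], which is
     continuous and vanishes at 0. *)
  have cvg0 : (h^-1 *: ((pospow m.+2 \o shift 0) (h *: 1) - pospow m.+2 0)
                @[h --> 0^'] --> (0 : R))%classic.
    have h : (pospow m.+1 x @[x --> 0^'] --> (0 : R))%classic.
      rewrite -[X in (_ --> X)%classic](@pospow_out m 0)//.
      by apply: cvg_within_filter; exact: continuous_pospow.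
    apply: cvg_trans h; apply: near_eq_cvg; near=> y.
    have y0 : y != 0 by near: y; exact: nbhs_dnbhs_neq.
    rewrite /= addr0 (@pospow_out _ 0)// subr0 /GRing.scale/= mulr1.
    have [yn|yp|ye] := ltgtP y 0; last by rewrite ye eqxx in y0.
      by rewrite !pospow_out ?ltW// mulr0.
    by rewrite !pospow_in ?ltW// [y ^+ m.+2]exprS mulKf.
  apply: DeriveDef; first by apply/cvg_ex; exists 0.
  exact: cvg_lim.
Unshelve. all: by end_near.
Qed.

(** Differentiation commutes with translation, hence with [backward_diff]. *)
Lemma is_derive_iter_bdiff m n x :
  is_derive x 1 (bdiff n (pospow m.+2))
    (m.+2%:R * bdiff n (pospow m.+1) x).
Proof.
elim: n x => [|n IHn] x; first exact: is_derive_pospow.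
rewrite !iterS /backward_diff mulrBr.
apply: is_deriveB => //.
rewrite -[X in is_derive _ _ _ X]mulr1.
apply: (@is_derive1_comp _ (bdiff n (pospow m.+2)) (fun y => y - 1)).
exact: is_derive_shift.
Qed.

(** * Integration of the iterated differences *)

Local Open Scope classical_set_scope.
Local Notation T := (measurableTypeR R).

Lemma continuous_iter_bdiff m n : continuous (bdiff n (pospow m) : R -> R).
Proof.
elim: n => [|n IHn] x; first exact: continuous_pospow.
apply: continuousB; first exact: IHn.
apply: (continuous_comp _ (IHn _)).
by apply: continuousB => //; exact: cst_continuous.
Qed.

Lemma continuous_FTC2_is_derive (f F : R -> R) (a b : R) : a < b ->
  continuous f -> (forall x : R, is_derive x 1 F (f x)) ->
  (\int[lebesgue_measure]_(x in `[a, b]) (f x)%:E = (F b - F a)%:E)%E.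
Proof.
move=> ab cf dF; have cF : continuous F.
  by move=> x; apply/differentiable_continuous/derivable1_diffP.
rewrite EFinB; apply: continuous_FTC2 => //.
- exact: continuous_subspaceT.
- split.
  + by move=> x _; exact: ex_derive.
  + by apply: cvg_at_right_filter; exact: cF.
  + by apply: cvg_at_left_filter; exact: cF.
- by move=> x _; rewrite derive1E derive_val.
Qed.

(** As |x| is even, each half of [-1, 1] contributes the integral of [h] over [y - 1, y]. Its
    antiderivative is [H] divided by m + 2, and H y - H (y - 1) is one more backward difference. *)
Lemma integral_iter_bdiff_norm m n (y : R) :
  (\int[lebesgue_measure]_(x in `[(-1)%R, 1%R])
      (bdiff n (pospow m.+1) (y - `|x|)%R)%:E =
   (2 / m.+2%:R * bdiff n.+1 (pospow m.+2) y)%:E)%E.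
Proof.
set h := bdiff n (pospow m.+1); set H := bdiff n (pospow m.+2).
have ch : continuous h by exact: continuous_iter_bdiff.
have dH (x : R) : is_derive x 1 H (m.+2%:R * h x) by exact: is_derive_iter_bdiff.
have -> : bdiff n.+1 (pospow m.+2) y = H y - H (y - 1) by [].
have m0 : m.+2%:R != 0 :> R by [].
have cN : continuous (fun x : R => h (y - `|x|)).
  move=> x; apply: (@continuous_comp _ _ _ (fun x : R => y - `|x|) h _ _ (ch _)).
  by apply: continuousB; [exact: cst_continuous|exact: norm_continuous].
have cD : continuous (fun x : R => h (y + x)).
  move=> x; apply: (@continuous_comp _ _ _ (fun x : R => y + x) h _ _ (ch _)).
  by apply: continuousD => //; exact: cst_continuous.
have cB : continuous (fun x : R => h (y - x)).
  move=> x; apply: (@continuous_comp _ _ _ (fun x : R => y - x) h _ _ (ch _)).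
  by apply: continuousB => //; exact: cst_continuous.
have mf (f : R -> R) (D : set R) : measurable D -> continuous f ->
    measurable_fun D f.
  by move=> mD cf; apply: measurable_funTS => //; exact: continuous_measurable_fun.
(* The half-open cut at 0 keeps the pieces disjoint; [integral_itv_bndo_bndc] then restores the
   endpoint, a null set. *)
have -> : `[-1, 1] = `[-1, 0[ `|` `[0, 1] :> set R.
  by rewrite -itv_bndbnd_setU// bnd_simp.
rewrite integral_setU//=; last 2 first.
  - by apply/measurable_EFinP; apply: mf cN; exact: measurableU.
  - apply/disj_setPS => x [] /=; rewrite !in_itv/= => /andP[_ x0] /andP[].
    by rewrite leNgt x0.
rewrite integral_itv_bndo_bndc; last by apply/measurable_EFinP; exact: mf.
transitivity (((H y - H (y - 1)) / m.+2%:R)%:E +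
              ((H y - H (y - 1)) / m.+2%:R)%:E)%E; last first.
  by rewrite -EFinD; congr EFin; field.
have dHD (x : R) :
    is_derive x 1 (fun x => m.+2%:R^-1 * H (y + x)) (h (y + x)).
  have -> : h (y + x) = m.+2%:R^-1 * (m.+2%:R * h (y + x) * 1) by field.
  apply: is_deriveZ; apply: (@is_derive1_comp _ H (fun x => y + x)).
  rewrite -[X in is_derive _ _ _ X]add0r; apply: is_deriveD.
have dHB (x : R) :
    is_derive x 1 (fun x => - m.+2%:R^-1 * H (y - x)) (h (y - x)).
  have -> : h (y - x) = - m.+2%:R^-1 * (m.+2%:R * h (y - x) * - 1) by field.
  apply: is_deriveZ; apply: (@is_derive1_comp _ H (fun x => y - x)).
  rewrite -[X in is_derive _ _ _ X]sub0r; apply: is_deriveB.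
congr (_ + _)%E.
  transitivity (\int[lebesgue_measure]_(x in `[(-1)%R, 0%R]) (h (y + x)%R)%:E)%E.
    apply: eq_integral => x; rewrite inE/= in_itv/= => /andP[_ x0].
    by rewrite ler0_norm// opprK.
  rewrite (continuous_FTC2_is_derive _ _ _ _ _ cD dHD)//.
  by congr EFin; rewrite addr0; field.
transitivity (\int[lebesgue_measure]_(x in `[0%R, 1%R]) (h (y - x)%R)%:E)%E.
  apply: eq_integral => x; rewrite inE/= in_itv/= => /andP[x0 _].
  by rewrite ger0_norm.
rewrite (continuous_FTC2_is_derive _ _ _ _ _ cB dHB)//.
by congr EFin; rewrite subr0; field.
Qed.

(** * Volume of the truncated cube by slicing *)

Definition truncated_cube n (y : R) : set (n.-tuple T) :=
  [set t | (forall i, `|tnth t i| <= 1 :> R) /\ \sum_i `|tnth t i| <= y :> R].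

(** Fixing the first coordinate uses up |x| of the bound. The rest [y - |x|] may be negative, so [y]
    has to range over all reals. *)
Lemma xsection_truncated_cube n y (x : T) :
  xsection (@cons_pair R n @^-1` truncated_cube n.+1 y) x =
  if `|x| <= 1 :> R then truncated_cube n (y - `|x|) else set0.
Proof.
apply/seteqP; split => t; rewrite /xsection /= ?inE /truncated_cube /=.
  case=> t1; rewrite big_ord_recl -lerBrDl => ty.
  have := t1 ord0; rewrite (_ : tnth _ ord0 = x)// => ->; split => [i|].
    by have := t1 (lift ord0 i); rewrite /cons_pair tnthS.
  by under eq_bigr do rewrite -(tnthS x).
case: ifP => // x1 [t1 ty]; split => [i|].
  have [->//|] := eqVneq i ord0.
  by rewrite eq_sym => /unlift_some[j -> _]; rewrite tnthS.
rewrite big_ord_recl -lerBrDl.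
by under eq_bigr do rewrite tnthS.
Qed.

Lemma lebesgue_truncated_segment y :
  lebesgue_tuple R 1 (truncated_cube 1 y) =
  (2 * bdiff 1 (pospow 1) y)%:E.
Proof.
pose r : R := Num.min 1 y.
have rE : [set x : R | `|x| <= r] = `[- r, r].
  by apply/seteqP; split => x /=; rewrite in_itv/= -ler_norml.
have -> : truncated_cube 1 y =
    [set t | forall i, [set x : R | `|x| <= r] (tnth t i)].
  apply/seteqP; split => t; rewrite /truncated_cube /= big_ord1.
    by case=> t1 ty i; rewrite (ord1 i) /r le_min ty andbT.
  move=> tr; have := tr ord0; rewrite le_min => /andP[t1 ty].
  by split=> // i; rewrite (ord1 i).
rewrite rE (@lebesgue_tuple_box R 1 (fun=> `[- r, r])); last first.
  by move=> i; exact: measurable_itv.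
(* The difference max(0, y) - max(0, y - 1) is [y] clamped to [0, 1], that is, half the length of
   the segment, also for negative [y]. *)
have -> : bdiff 1 (pospow 1) y = Num.max 0 r.
  rewrite /= /backward_diff /pospow !expr1 /r.
  have [y1|y1] := leP 1 y.
    rewrite (max_idPr _); last lra.
    rewrite (max_idPr _); last lra.
    rewrite (max_idPr _); last lra.
    lra.
  by rewrite [X in _ - X](max_idPl _) ?subr0//; lra.
rewrite big_ord1 lebesgue_measure_itv/= lte_fin -EFinB.
have [r0|r0] := ltP 0 r.
  by rewrite ifT; [congr EFin; lra|lra].
by rewrite ifF ?mulr0//; apply/negbTE; rewrite -leNgt; lra.
Qed.

Lemma lebesgue_truncated_cube n y :
  lebesgue_tuple R n.+1 (truncated_cube n.+1 y) =
  (2 ^+ n.+1 / n.+1`!%:R * bdiff n.+1 (pospow n.+1) y)%:E.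
Proof.
elim: n y => [|n IHn] y.
  by rewrite lebesgue_truncated_segment expr1 divr1.
pose c : R := 2 ^+ n.+1 / n.+1`!%:R.
transitivity (\int[@lebesgue_measure R]_(x in `[(-1)%R, 1%R])
    (c%:E * (bdiff n.+1 (pospow n.+1) (y - `|x|)%R)%:E))%E.
  (* The left side unfolds to the integral of the measures of the sections; those with |x| > 1 are
     empty, which leaves [-1, 1]. *)
  rewrite [RHS]integral_mkcond; apply: eq_integral => x _.
  rewrite /= xsection_truncated_cube patchE mem_setE in_itv/= -ler_norml.
  by case: ifP => _; rewrite ?measure0// IHn EFinM.
rewrite integralZl//; last first.
  apply: continuous_compact_integrable; first exact: segment_compact.
  apply: continuous_subspaceT => x.
  apply: (@continuous_comp _ _ _ (fun x : R => y - `|x|)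
    (bdiff n.+1 (pospow n.+1))); last exact: continuous_iter_bdiff.
  by apply: continuousB; [exact: cst_continuous|exact: norm_continuous].
rewrite integral_iter_bdiff_norm -EFinM mulrA; congr (_ * _)%:E.
rewrite /c [2 ^+ n.+2]exprS [n.+2`!]factS natrM; field.
by rewrite -natrD !pnatr_eq0 -lt0n fact_gt0.
Qed.

(** * Expansion into the closed formula *)

Lemma iter_bdiff_pospow_truncn d (k : R) : 1 <= k <= d.+1%:R ->
  bdiff d.+1 (pospow d.+1) k =
  \sum_(0 <= i < (Num.truncn k).+1)
     (-1) ^+ i * 'C(d.+1, i)%:R * (k - i%:R) ^+ d.+1.
Proof.
move=> /andP[k1 kd]; have k0 : 0 <= k by lra.
rewrite iter_backward_diff.
(* The binomial sum has indices up to d + 1, so the bound on [k] allows cutting it after the integer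
   part of [k]. Later terms vanish because k - i <= 0; in earlier ones the truncation is
   inactive. *)
have td : (Num.truncn k < d.+2)%N.
  by rewrite ltnS -(ler_nat R) (le_trans _ kd)// truncn_le.
rewrite -(big_mkord xpredT (fun i => (-1) ^+ i * 'C(d.+1, i)%:R * _ (k - i%:R))).
rewrite (big_cat_nat _ td)//= [X in _ + X]big_nat_cond [X in _ + X]big1;
  last first.
  move=> i; rewrite andbT => /andP[ti _]; rewrite pospow_out ?mulr0// subr_le0.
  by rewrite (le_trans (ltW (truncnS_gt k)))// ler_nat.
rewrite addr0; apply: eq_big_nat => i /andP[_ it].
rewrite pospow_in// subr_ge0 (le_trans _ (_ : (Num.truncn k)%:R <= k))//.
  by rewrite ler_nat.
by rewrite truncn_le.
Qed.

End truncated_cube.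

Theorem theorem4p4 (R : realType) (d : nat) (k : R) :
  (1 <= d)%N -> 1 <= k <= d%:R ->
  volume (rho_star d k) =
  (2 ^+ d * \sum_(0 <= i < (Num.truncn k).+1)
     (-1) ^+ i * (k - i%:R) ^+ d / (i`!%:R * (d - i)`!%:R))%:E.
Proof.
case: d => [//|d] _ kd; have /andP[k1 k2] := kd.
rewrite rho_starE ?(lt_le_trans _ k1)// /volume.
have -> : [set t | [set y : 'rV[R]_d.+1 | (forall i, `|y 0 i| <= 1) /\
      \sum_i `|y 0 i| <= k]%classic (\row_i tnth t i)]%classic =
    truncated_cube R d.+1 k.
  apply/seteqP; split => t [t1 tk]; split => [i|].
  - by have := t1 i; rewrite mxE.
  - by move: tk; under eq_bigr do rewrite mxE.
  - by rewrite mxE; exact: t1.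
  - by under eq_bigr do rewrite mxE.
rewrite lebesgue_truncated_cube iter_bdiff_pospow_truncn//.
rewrite -mulrA; congr (_ * _)%:E; rewrite mulr_sumr.
apply: eq_big_nat => i /andP[_]; rewrite ltnS => it.
have id : (i <= d.+1)%N.
  rewrite (leq_trans it)// -(ler_nat R) (le_trans _ k2)// truncn_le; lra.
(* Writing (d+1)! as C(d+1, i) i! (d+1-i)! cancels the binomial coefficient. *)
have := bin_fact id => /(congr1 (fun n => n%:R : R)) /=.
rewrite !natrM => <-; field.
by rewrite !pnatr_eq0 -!lt0n !fact_gt0 bin_gt0.
Qed.
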